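(* Let $k,n\in\mathbb{N}$ with $k\le n$, and let $\mathcal{A}=\{\{i,i+1,\ldots,i+k-1\}: i\in[n]\}\subseteq\binom{[n]}{k}$, with indices taken cyclically modulo $n$ (in $\{1,\ldots,n\}$). Let $G_{\mathcal{A}}$ be the graph on vertex set $\mathcal{A}$ with edge set $\{(S,S'): S\cap S'\neq\emptyset\}$ (including self-loops). Consider the test $\mathcal{T}$ which, on input $F\in\mathcal{F}_{\mathcal{A}}$, picks $S\in\mathcal{A}$ uniformly at random, then picks $S'\in\mathcal{A}$ uniformly at random among those with $S\cap S'\neq\emptyset$, and accepts iff $F(S)|_{S\cap S'}=F(S')|_{S\cap S'}$. Let $\varepsilon\ge0$ and $F\in\mathcal{F}_{\mathcal{A}}$. If $F$ passes $\mathcal{T}$ with probability $1-\varepsilon$, then $F$ is $(1-4\varepsilon)$-close to $\mathrm{dec}(F)$.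
   Context: For $V\subseteq\mathcal{P}([n])$, $\mathcal{F}_V$ is the set of all maps $F$ assigning to each $S\in V$ a function $F(S)\in\{0,1\}^S$. For $a\in\{0,1\}^n$, $\mathrm{DP}_V(a)\in\mathcal{F}_V$ is given by $\mathrm{DP}_V(a)(S)=a|_S$. For $F,H\in\mathcal{F}_V$, $\Delta(F,H)=|\{S\in V: F(S)\neq H(S)\}|/|V|$, and $F$ is $(1-\delta)$-close to $H$ if $\Delta(F,H)\le\delta$. For $F\in\mathcal{F}_V$, $a^F_i$ is the majority value of $F(S)_i$ over all $S\in V$ containing $i$, and $\mathrm{dec}(F)=\mathrm{DP}_V(a^F)$. *)

(* Defs.v *)
From mathcomp Require Import all_boot all_order all_algebra.

Set Implicit Arguments.
Unset Strict Implicit.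
Unset Printing Implicit Defensive.

Import Order.TTheory GRing.Theory Num.Theory.
Local Open Scope ring_scope.

(* Ground set ['I_n], i.e. {0, .., n-1} in place of [n] = {1, .., n}; the      *)
(* truth values are [bool].                                                   *)

Definition local_fun (n : nat) (S : {set 'I_n}) := {ffun {i | i \in S} -> bool}.

(* F_V *)
Definition local_family (n : nat) (V : {set {set 'I_n}}) :=
  forall S : {S | S \in V}, local_fun (val S).

Definition restrict (n : nat) (S T : {set 'I_n}) (sTS : T \subset S)
    (f : local_fun S) : local_fun T :=
  [ffun i => f (Sub (val i) (subsetP sTS (val i) (valP i)))].

Definition DP (n : nat) (V : {set {set 'I_n}}) (a : {ffun 'I_n -> bool}) :
    local_family V :=
  fun S => [ffun i => a (val i)].

Definition dist (R : realFieldType) (n : nat) (V : {set {set 'I_n}})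
    (F H : local_family V) : R :=
  #|[set S | F S != H S]|%:R / #|V|%:R.

(* [close (1 - d) F H] is "F is (1 - d)-close to H", i.e. dist F H <= d. *)
Definition close (R : realFieldType) (c : R) (n : nat) (V : {set {set 'I_n}})
    (F H : local_family V) : Prop :=
  dist R F H <= 1 - c.

(* The number of S in V such that i \in S and F(S)_i = b. *)
Definition votes (n : nat) (V : {set {set 'I_n}}) (F : local_family V)
    (i : 'I_n) (b : bool) : nat :=
  #|[set S | [exists j, (val j == i) && (F S j == b)]]|.

(* [tie i] is the value chosen when the vote at i is tied (in particular when *)
(* no S in V contains i).                                                     *)
Definition majority (n : nat) (V : {set {set 'I_n}})
    (tie : {ffun 'I_n -> bool}) (F : local_family V) : {ffun 'I_n -> bool} :=
  [ffun i => if (votes F i false < votes F i true)%N then true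
             else if (votes F i true < votes F i false)%N then false
             else tie i].

Definition dec (n : nat) (V : {set {set 'I_n}})
    (tie : {ffun 'I_n -> bool}) (F : local_family V) : local_family V :=
  DP (majority tie F).

(* {i, i+1, .., i+k-1} modulo n *)
Definition cyclic_interval (n k : nat) (i : 'I_n) : {set 'I_n} :=
  [set j | [exists t : 'I_k, val j == ((i + t) %% n)%N]].

Definition cyclic_intervals (n k : nat) : {set {set 'I_n}} :=
  [set cyclic_interval k i | i : 'I_n].

(* Edge relation of the graph on V joining the intersecting pairs. *)
Definition intersection_graph (n : nat) (V : {set {set 'I_n}}) :
    rel {S | S \in V} :=
  fun S S' => val S :&: val S' != set0.

Definition neighbours (n : nat) (V : {set {set 'I_n}}) (S : {S | S \in V}) :
    {set {S | S \in V}} :=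
  [set S' | intersection_graph S S'].

Definition accepts (n : nat) (V : {set {set 'I_n}}) (F : local_family V)
    (S S' : {S | S \in V}) : bool :=
  restrict (subsetIl (val S) (val S')) (F S)
    == restrict (subsetIr (val S) (val S')) (F S').

(* S is uniform in V, then S' is uniform among the neighbours of S. *)
Definition pass_prob (R : realFieldType) (n : nat) (V : {set {set 'I_n}})
    (F : local_family V) : R :=
  \sum_(S : {S | S \in V}) #|V|%:R^-1 *
    \sum_(S' in neighbours S) #|neighbours S|%:R^-1 * (accepts F S S')%:R.

(* Main.v *)
Require Import Defs.
From mathcomp Require Import all_boot all_order all_algebra.
From mathcomp Require Import zify lra.

Set Implicit Arguments.
Unset Strict Implicit.
Unset Printing Implicit Defensive.

Import Order.TTheory GRing.Theory Num.Theory.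
Local Open Scope ring_scope.

(** An interval meeting S has the same length as S, so it contains one of the
    two endpoints of S.  By rotation invariance every point lies in the same
    number N of intervals, hence S has at most 2N neighbours.  If F(S) differs
    from the majority at some i in S, then at least half of the N intervals
    containing i carry the majority value at i, and each of them is a neighbour
    of S on which the test rejects.  So a disagreeing S is rejected with
    conditional probability at least 1/4. *)

(** Trades remainders for addition in the cyclic group ['I_n.+1], where translations are easy to
    handle. *)
Lemma mem_cyclic_interval n k (i j : 'I_n.+1) :
  reflect (exists2 t, (t < k)%N & j = i + inZp t) (j \in cyclic_interval k i).
Proof.
rewrite inE; apply: (iffP existsP) => [[t /eqP jE]|[t tk ->]].
  exists (val t); first exact: ltn_ord.
  by apply: ord_inj; rewrite /= jE modnDmr.
by exists (Ordinal tk); rewrite /= modnDmr.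
Qed.

Lemma cyclic_interval_shift n k (i c : 'I_n.+1) :
  [set x + c | x in cyclic_interval k i] = cyclic_interval k (i + c).
Proof.
apply/setP => j; apply/imsetP/mem_cyclic_interval.
  by case=> x /mem_cyclic_interval[t tk ->] ->; exists t => //; rewrite addrAC.
case=> t tk ->; exists (i + inZp t); last by rewrite addrAC.
by apply/mem_cyclic_interval; exists t.
Qed.

(** Translation by [j - i] injects the intervals through [i] into those through [j]. *)
Lemma leq_card_cyclic_intervals_mem n k (i j : 'I_n) :
  (#|[set S in cyclic_intervals n k | i \in S]|
     <= #|[set S in cyclic_intervals n k | j \in S]|)%N.
Proof.
case: n i j => [|n] i j; first by case: i.
pose f (S : {set 'I_n.+1}) := [set x + (j - i) | x in S].
have f_inj : injective f by apply/imset_inj/addIr.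
rewrite -(card_imset _ f_inj); apply/subset_leq_card/subsetP => T /imsetP[S].
rewrite inE => /andP[/imsetP[s _ ->] iS] ->; rewrite inE; apply/andP; split.
  by rewrite /f cyclic_interval_shift imset_f.
by apply/imsetP; exists i => //; rewrite addrC subrK.
Qed.

Lemma meet_cyclic_interval n k (s t x : 'I_n.+1) :
    x \in cyclic_interval k s -> x \in cyclic_interval k t ->
  (s \in cyclic_interval k t) || (s + inZp k.-1 \in cyclic_interval k t).
Proof.
have inZpD a b : inZp (a + b) = inZp a + inZp b :> 'I_n.+1.
  by apply: ord_inj; rewrite /= modnDm.
move=> /mem_cyclic_interval[a ak ->] /mem_cyclic_interval[b bk] /eqP.
(* The common point is [s + a = t + b]. If [a <= b], then [s = t + (b - a)]; otherwise
   [t = s + (a - b)], and the last point of the first interval is [t + (k - 1 - (a - b))]. *)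
case: (leqP a b) => [ab|/ltnW ba] st; apply/orP; [left|right];
  apply/mem_cyclic_interval.
  exists (b - a)%N; first lia.
  apply: (addIr (inZp a)); rewrite (eqP st) -addrA -inZpD.
  by rewrite subnK.
exists (k.-1 - (a - b))%N; first lia.
have -> : t = s + inZp (a - b).
  apply: (addIr (inZp b)); rewrite -(eqP st) -addrA -inZpD.
  by rewrite subnK.
by rewrite -addrA -inZpD subnKC //; lia.
Qed.

(** Neighbours and votes are counted in the sigma type, while translations act on bare sets; this
    transfers the counts. *)
Lemma card_sig_mem n (V : {set {set 'I_n}}) (i : 'I_n) :
  #|[set S : {S | S \in V} | i \in val S]| = #|[set S in V | i \in S]|.
Proof.
rewrite -(card_imset _ val_inj); apply: eq_card => S; rewrite [in RHS]inE.
apply/imsetP/andP => [[T]|[SV iS]]; first by rewrite inE => iT ->; case: T iT.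
by exists (exist _ S SV); rewrite ?inE.
Qed.

Lemma card_neighbours_cyclic_intervals n k
    (S : {S | S \in cyclic_intervals n k}) (i : 'I_n) :
  (#|neighbours S| <= (#|[set T : {T | T \in cyclic_intervals n k}
                           | i \in val T]|).*2)%N.
Proof.
case: n S i => [|n] S i; first by case: i.
have /imsetP[s _ SE] := valP S.
pose N j := [set T : {T | T \in cyclic_intervals n.+1 k} | j \in val T].
have N_le j : (#|N j| <= #|N i|)%N.
  by rewrite !card_sig_mem leq_card_cyclic_intervals_mem.
have sub : neighbours S \subset N s :|: N (s + inZp k.-1).
  apply/subsetP => T; rewrite !inE => /set0Pn[x]; rewrite inE SE.
  by have /imsetP[t _ ->] := valP T => /andP[]; apply: meet_cyclic_interval.
apply: (leq_trans (subset_leq_card sub)).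
rewrite cardsU -addnn; apply: (leq_trans (leq_subr _ _)).
exact: (leq_add (N_le _) (N_le _)).
Qed.

Section Family.
Variables (n : nat) (V : {set {set 'I_n}}) (F : local_family V).

Definition rejecting (S : {S | S \in V}) : {set {S | S \in V}} :=
  [set S' in neighbours S | ~~ accepts F S S'].

Lemma card_mem_votes (i : 'I_n) :
  (#|[set S : {S | S \in V} | i \in val S]| <= votes F i false + votes F i true)%N.
Proof.
rewrite /votes -cardsUI; apply/leq_trans/leq_addr.
apply/subset_leq_card/subsetP => S; rewrite inE => iS; rewrite !inE.
pose j : {i | i \in val S} := exist _ i iS.
case FSj: (F S j); apply/orP; [right|left]; apply/existsP; exists j;
  by rewrite eqxx FSj.
Qed.

Lemma card_mem_votes_majority tie (i : 'I_n) :
  (#|[set S : {S | S \in V} | i \in val S]|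
     <= (votes F i (majority tie F i)).*2)%N.
Proof.
have := card_mem_votes i; rewrite ffunE; case: ltnP => [|h1]; first lia.
(* In a tie each value holds at least half of the votes, so any [tie] will do. *)
by case: ltnP => [|h2]; [|case: (tie i)]; lia.
Qed.

(** A set voting [b] at [j] shares the point [j] with [S] and contradicts [F S] there. *)
Lemma votes_leq_rejecting (S : {S | S \in V}) (j : {i | i \in val S}) (b : bool) :
  F S j != b -> (votes F (val j) b <= #|rejecting S|)%N.
Proof.
move=> FSj; apply/subset_leq_card/subsetP => T; rewrite !inE.
move=> /existsP[j' /andP[/eqP j'E /eqP FTj']].
have jI : val j \in val S :&: val T by rewrite inE (valP j) -j'E (valP j').
apply/andP; split; first by apply/set0Pn; exists (val j).
apply/negP => /eqP/ffunP/(_ (exist _ (val j) jI)); rewrite !ffunE => FST.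
case/eqP: FSj; rewrite -FTj'; apply: etrans (etrans FST _).
  by congr (F S _); apply: val_inj.
by congr (F T _); apply: val_inj.
Qed.

Lemma sum_accepts (R : realFieldType) (S : {S | S \in V}) :
  \sum_(S' in neighbours S) (accepts F S S')%:R
    = #|neighbours S|%:R - #|rejecting S|%:R :> R.
Proof.
apply/eqP; rewrite eq_sym subr_eq -natr_sum -natrD eqr_nat; apply/eqP.
rewrite -!sum1_card [X in (_ + X)%N](eq_bigl
  (fun S' => (S' \in neighbours S) && ~~ accepts F S S')); last first.
  by move=> T; rewrite inE.
rewrite big_mkcondr -big_split /=; apply: eq_bigr => T _.
by case: (accepts F S T).
Qed.

End Family.

Lemma card_neighbours_leq_rejecting n k
    (F : local_family (cyclic_intervals n k)) tie S :
  F S != dec tie F S -> (#|neighbours S| <= 4 * #|rejecting F S|)%N.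
Proof.
move=> bad; have [j FSj] : exists j, F S j != majority tie F (val j).
  apply/existsP; apply: contraNT bad => /existsPn h; apply/eqP/ffunP => j.
  by rewrite ffunE; apply/eqP; rewrite -[_ == _]negbK h.
(* One factor 2 pays for the two endpoints of [S], the other for the majority being only half of the
   votes. *)
rewrite -[4%N]/(2 * 2)%N -mulnA !mul2n.
apply: (leq_trans (card_neighbours_cyclic_intervals S (val j))).
rewrite leq_double; apply: (leq_trans (card_mem_votes_majority F tie (val j))).
by rewrite leq_double (votes_leq_rejecting FSj).
Qed.

Lemma pass_prob_at_le (R : realFieldType) n k
    (F : local_family (cyclic_intervals n k)) tie S :
  \sum_(S' in neighbours S) #|neighbours S|%:R^-1 * (accepts F S S')%:R
    <= 1 - (F S != dec tie F S)%:R / 4%:R :> R.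
Proof.
rewrite -mulr_sumr sum_accepts.
have := @card_neighbours_leq_rejecting n k F tie S.
set r := #|rejecting F S|; set d := #|neighbours S|.
have d_ge0 : 0 <= d%:R :> R by rewrite ler0n.
have r_ge0 : 0 <= r%:R :> R by rewrite ler0n.
(* Only an empty [S] has no neighbours; its inner sum is then 0, which is below 3/4. *)
case: (posnP d) => [-> _|d_gt0 bad].
  by rewrite invr0 mul0r; case: (F S != _) => /=; lra.
rewrite mulrC ler_pdivrMr ?ltr0n //.
case: (F S != _) bad => [/(_ isT)|_] /=; last by lra.
by rewrite -(ler_nat R) natrM; lra.
Qed.

Theorem theorem5p1 (R : realFieldType) (k n : nat) (hkn : (k <= n)%N)
    (tie : {ffun 'I_n -> bool}) (eps : R) (heps : 0 <= eps)
    (F : local_family (cyclic_intervals n k))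
    (hF : pass_prob R F = 1 - eps) :
  close (1 - 4%:R * eps) F (dec tie F).
Proof.
set V := cyclic_intervals n k in F hF *.
have : pass_prob R F <= 1 - dist R F (dec tie F) / 4%:R.
  apply: (@le_trans _ _
    (\sum_S #|V|%:R^-1 * (1 - (F S != dec tie F S)%:R / 4%:R))).
    apply: ler_sum => S _; rewrite ler_wpM2l ?invr_ge0 ?ler0n //.
    exact: pass_prob_at_le.
  rewrite -mulr_sumr sumrB sumr_const card_sig -mulr_suml mulrBr /dist.
  have -> : \sum_S (F S != dec tie F S)%:R
              = #|[set S | F S != dec tie F S]|%:R :> R.
    rewrite -natr_sum -sum1_card [in RHS]big_mkcond /=; congr _%:R.
    by apply: eq_bigr => S _; rewrite inE; case: (F S != _).
  rewrite mulrA [_^-1 * _%:R in X in _ - X]mulrC lerD2r.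
  (* The weights sum to 1, or to 0 when [V] is empty; either way the bound holds. *)
  by have [->|V0] := eqVneq (#|V|%:R : R) 0; rewrite ?mulr0 ?mulVf //; lra.
rewrite /close hF; lra.
Qed.
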